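(* Let $\varphi\in L^2(\mathbb{R}^2)$ satisfy $\operatorname{supp}(\varphi)\subseteq[N_1,M_1]\times[N_2,M_2]$, suppose that $\{\varphi(\cdot-\boldsymbol{k}):\boldsymbol{k}\in\mathbb{Z}^2\}$ is linearly independent, and let $\boldsymbol{p}=(\cos\theta,\sin\theta)$ be a direction vector such that $\mathcal{R}_{\boldsymbol{p}}\varphi$ is continuous. Let $f\in V(\varphi,\mathbb{Z}^2)$ be an arbitrary target function with $\operatorname{supp}(f)\subseteq[a_1,b_1]\times[a_2,b_2]$. Let $$E=\big([\lceil a_1-M_1\rceil,\lfloor b_1-N_1\rfloor]\times[\lceil a_2-M_2\rceil,\lfloor b_2-N_2\rfloor]\big)\cap\mathbb{Z}^2=\{\boldsymbol{k}_1,\dots,\boldsymbol{k}_{\#E}\}.$$ Then $f$ can be determined uniquely by its single-angle Radon samples (with respect to $\boldsymbol{p}$) at $X=\{x_1,\dots,x_{\#E}\}\subseteq\mathbb{R}$ if and only if the $\#E\times\#E$ matrix $$A_{\varphi,\boldsymbol{p},X}=\big(\mathcal{R}_{\boldsymbol{p}}\varphi(x_j-\boldsymbol{p}\boldsymbol{k}_n)\big)_{j,n=1}^{\#E}$$ is invertible.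
   Context: Vectors in $\mathbb{R}^2$ are columns; the direction vector $\boldsymbol{p}=(\cos\theta,\sin\theta)$ is a row vector, so $\boldsymbol{p}\boldsymbol{k}=k_1\cos\theta+k_2\sin\theta\in\mathbb{R}$. The Radon transform at the single angle $\theta$ is $\mathcal{R}_{\boldsymbol{p}}f(t)=\int_{-\infty}^{\infty}f(t\cos\theta-s\sin\theta,\,t\sin\theta+s\cos\theta)\,ds$. Continuity of $\mathcal{R}_{\boldsymbol{p}}\varphi$ is understood after modification on a null set, and samples are values of the continuous representative. The shift-invariant space is $V(\varphi,\mathbb{Z}^2)=\{\sum_{\boldsymbol{k}\in\mathbb{Z}^2}c_{\boldsymbol{k}}\varphi(\cdot-\boldsymbol{k}):\sum_{\boldsymbol{k}}|c_{\boldsymbol{k}}|^2<\infty\}$. $\#E$ is the cardinality of $E$. Standing convention: a target function $f\in V(\varphi,\mathbb{Z}^2)$ with $\operatorname{supp}(f)\subseteq[a_1,b_1]\times[a_2,b_2]$ is one expressed as $f=\sum_{l=1}^{\#E}c_{\boldsymbol{k}_l}\varphi(\cdot-\boldsymbol{k}_l)$ with complex coefficients; then $\mathcal{R}_{\boldsymbol{p}}f=\sum_l c_{\boldsymbol{k}_l}\mathcal{R}_{\boldsymbol{p}}\varphi(\cdot-\boldsymbol{p}\boldsymbol{k}_l)$. ''$f$ can be determined uniquely by its single-angle Radon samples at $X$'' means that $f$ is the only function $h$ of the form $\sum_{l=1}^{\#E}d_l\varphi(\cdot-\boldsymbol{k}_l)$, $d_l\in\mathbb{C}$, with $\mathcal{R}_{\boldsymbol{p}}h(x)=\mathcal{R}_{\boldsymbol{p}}f(x)$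 for all $x\in X$. *)

(* Defs.v *)
From HB Require Import structures.
From mathcomp Require Import all_boot all_order all_algebra.
From mathcomp Require Import finmap.
From mathcomp Require Import all_classical all_reals all_analysis.
From mathcomp Require Import complex.
Import Order.TTheory GRing.Theory Num.Theory.
Import numFieldNormedType.Exports.

Set Implicit Arguments.
Unset Strict Implicit.
Unset Printing Implicit Defensive.

Local Open Scope classical_set_scope.
Local Open Scope ring_scope.

(* The modulus of a complex number, with values in [R] rather than in [R[i]]. *)
Local Notation normc := (@ComplexField.Normc.normc _).

Local Notation leb R := (@lebesgue_measure R).
Local Notation leb2 R := (@lebesgue_measure R \x @lebesgue_measure R)%E.

(* An element of L^2(R^2; C) is given by a Borel representative; equality in
   L^2 is equality almost everywhere. *)
Definition L2 (R : realType) (f : R * R -> R[i]) : Prop :=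
  [/\ measurable_fun [set: R * R] (fun x => complex.Re (f x)),
      measurable_fun [set: R * R] (fun x => complex.Im (f x)) &
      ('N[leb2 R]_(2%:E)[EFin \o (fun x : R * R => normc (f x))] < +oo)%E].

(* The support of an almost-everywhere class: the complement of the union of
   the open sets on which the function vanishes almost everywhere. *)
Definition ess_supp (R : realType) (f : R * R -> R[i]) : set (R * R) :=
  ~` \bigcup_(U in [set U : set (R * R) |
       open U /\ {ae leb2 R, forall x, U x -> f x = 0}]) U.

Definition int_shift (R : realType) (phi : R * R -> R[i]) (z : int * int) :
    R * R -> R[i] :=
  fun x => phi (x.1 - z.1%:~R, x.2 - z.2%:~R).

Definition shifts_independent (R : realType) (phi : R * R -> R[i]) : Prop :=
  forall (B : {fset (int * int)}) (c : int * int -> R[i]),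
    {ae leb2 R, forall x, \sum_(z <- B) c z * int_shift phi z x = 0} ->
    forall z, z \in B -> c z = 0.

(* V(phi, Z^2): the series converges unconditionally in L^2. *)
Definition shift_invariant_space (R : realType) (phi : R * R -> R[i]) :
    set (R * R -> R[i]) :=
  [set f : R * R -> R[i] | L2 f /\ exists c : int * int -> R[i],
    (\esum_(z in [set: int * int]) (normc (c z) ^+ 2)%R%:E < +oo)%E /\
    forall e : R, 0 < e -> exists B0 : {fset (int * int)},
      forall B : {fset (int * int)}, (B0 `<=` B)%fset ->
      ('N[leb2 R]_(2%:E)
         [EFin \o (fun x : R * R =>
           normc (f x - \sum_(z <- B) c z * int_shift phi z x)%R)]
       <= e%:E)%E].

Definition pdot (R : realType) (theta : R) (z : int * int) : R :=
  z.1%:~R * cos theta + z.2%:~R * sin theta.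

Definition radon (R : realType) (theta : R) (f : R * R -> R[i]) (t : R) :
    R[i] :=
  let line s := (t * cos theta - s * sin theta,
                 t * sin theta + s * cos theta) in
  Complex (\int[leb R]_s complex.Re (f (line s)))
          (\int[leb R]_s complex.Im (f (line s))).

(* [R[i]^o] is [R[i]] with the topology of its norm. *)
Definition continuous_radon_rep (R : realType) (theta : R)
    (f : R * R -> R[i]) : set (R -> R[i]) :=
  [set g : R -> R[i] | continuous (g : R -> R[i]^o) /\
           {ae leb R, forall t, g t = radon theta f t}].

Definition has_continuous_radon (R : realType) (theta : R)
    (f : R * R -> R[i]) : Prop :=
  exists g, continuous_radon_rep theta f g.

(* The continuous representative of the Radon transform, which is unique when
   it exists; the default value is only reached when there is none. *)
Definition radon_cont (R : realType) (theta : R) (f : R * R -> R[i]) :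
    R -> R[i] :=
  xget (radon theta f) (continuous_radon_rep theta f).

Definition index_set (R : realType) (N1 M1 N2 M2 a1 b1 a2 b2 : R) :
    set (int * int) :=
  [set z | (Num.ceil (a1 - M1) <= z.1 <= Num.floor (b1 - N1)) /\
           (Num.ceil (a2 - M2) <= z.2 <= Num.floor (b2 - N2))].

Definition shift_combination (R : realType) (phi : R * R -> R[i]) (m : nat)
    (k : 'I_m -> int * int) : set (R * R -> R[i]) :=
  [set h : R * R -> R[i] | L2 h /\ exists d : 'I_m -> R[i],
    {ae leb2 R, forall x, h x = \sum_(l < m) d l * int_shift phi (k l) x}].

Definition target_function (R : realType) (phi : R * R -> R[i])
    (a1 b1 a2 b2 : R) (m : nat) (k : 'I_m -> int * int) :
    set (R * R -> R[i]) :=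
  [set f : R * R -> R[i] | [/\ shift_invariant_space phi f,
               ess_supp f `<=` `[a1, b1] `*` `[a2, b2] &
               shift_combination phi k f]].

Definition determined_by_radon_samples (R : realType)
    (phi : R * R -> R[i]) (theta : R) (m : nat) (k : 'I_m -> int * int)
    (X : set R) (f : R * R -> R[i]) : Prop :=
  forall h, shift_combination phi k h ->
    (forall x, X x -> radon_cont theta h x = radon_cont theta f x) ->
    {ae leb2 R, forall y, h y = f y}.

Definition sampling_matrix (R : realType) (phi : R * R -> R[i]) (theta : R)
    (m : nat) (k : 'I_m -> int * int) (x : 'I_m -> R) : 'M[R[i]]_m :=
  \matrix_(j, n) radon_cont theta phi (x j - pdot theta (k n)).

(* Main.v *)
Require Import Defs.
From HB Require Import structures.
From mathcomp Require Import all_boot all_order all_algebra.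
From mathcomp Require Import finmap.
From mathcomp Require Import all_classical all_reals all_analysis.
From mathcomp Require Import measurable_realfun.
From mathcomp Require Import complex.
From mathcomp Require Import ring lra.
Import Order.TTheory GRing.Theory Num.Theory.
Import numFieldNormedType.Exports.

Set Implicit Arguments.
Unset Strict Implicit.
Unset Printing Implicit Defensive.

Local Open Scope classical_set_scope.
Local Open Scope ring_scope.

(* The Radon transform is linear and turns the shift by k into the shift by
   p k, so the samples of sum_l d_l phi(. - k_l) are the entries of A d; since
   the shifts of phi are independent, uniqueness of the reconstruction is
   injectivity of d |-> A d.  The analytic content is that this linearity
   holds for the continuous representatives: phi is square integrable and
   vanishes a.e. off a box, hence is integrable; plane rotations preserve
   Lebesgue measure (they are products of shears, which preserve it by
   Fubini), so by Fubini again phi is integrable on almost every line of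
   direction orthogonal to p, and planar null sets meet almost every such line
   in a null set. *)

(** * Measure-preserving maps and change of variables *)

Section MeasurePreserving.
Context d (T : measurableType d) (R : realType).
Variable mu : {measure set T -> \bar R}.

Definition measure_preserving (g : T -> T) : Prop :=
  measurable_fun [set: T] g /\
  forall A, measurable A -> mu (g @^-1` A) = mu A.

Lemma measure_preserving_comp g h : measure_preserving g ->
  measure_preserving h -> measure_preserving (g \o h).
Proof.
move=> [mg gE] [mh hE]; split; first exact: measurableT_comp.
move=> A mA; rewrite comp_preimage hE ?gE//.
by rewrite -[X in measurable X]setTI; exact: mg.
Qed.

Lemma measure_preserving_ae g (P : T -> Prop) : measure_preserving g ->
  {ae mu, forall x, P x} -> {ae mu, forall x, P (g x)}.
Proof.
move=> [mg gE] [N [mN N0 PN]]; exists (g @^-1` N); split.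
- by rewrite -[X in measurable X]setTI; exact: mg.
- by rewrite gE.
- by move=> x /= Px; exact: PN.
Qed.

(** The pushforward of [mu] along [g] takes the same values as [mu] on measurable sets, so the
    pushforward formula becomes invariance of the integral. *)
Lemma measure_preserving_ge0_integral g (F : T -> \bar R) :
  measure_preserving g -> measurable_fun [set: T] (F : T -> \bar R) ->
  (forall x, 0 <= F x)%E ->
  (\int[mu]_x F (g x) = \int[mu]_x F x)%E.
Proof.
move=> [mg gE] mF F0.
have := ge0_integral_pushforward mg mu measurableT mF (fun y _ => F0 y).
rewrite preimage_setT => <-.
by apply: eq_measure_integral => A mA _; exact: gE.
Qed.

Lemma measure_preserving_integral g (F : T -> \bar R) :
  measure_preserving g -> measurable_fun [set: T] (F : T -> \bar R) ->
  (\int[mu]_x F (g x) = \int[mu]_x F x)%E.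
Proof.
move=> mpg mF; rewrite integralE [RHS]integralE.
rewrite -(measure_preserving_ge0_integral mpg (measurable_funepos mF))//.
rewrite -(measure_preserving_ge0_integral mpg (measurable_funeneg mF))//.
by rewrite -[fun x => F (g x)]/(F \o g) funepos_comp funeneg_comp.
Qed.

Lemma measure_preserving_integrable g (F : T -> \bar R) :
  measure_preserving g -> mu.-integrable [set: T] F ->
  mu.-integrable [set: T] (F \o g).
Proof.
move=> mpg /integrableP[mF Foo]; apply/integrableP; split.
  by apply: measurableT_comp => //; case: mpg.
rewrite (measure_preserving_ge0_integral (F := fun x => `|F x|)%E mpg) //.
exact: measurableT_comp.
Qed.

End MeasurePreserving.

(* The library's hint for [Filter] does not unify with the measurable structure
   on which [lebesgue_measure] is defined. *)
#[local] Instance ae_lebesgue_filter (R : realType) :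
  Filter (nbhs (almost_everywhere (@lebesgue_measure R))).
Proof. exact: ae_filter_ringOfSetsType. Qed.

#[local] Instance ae_lebesgue2_filter (R : realType) : Filter (nbhs
  (almost_everywhere (@lebesgue_measure R \x @lebesgue_measure R)%E)).
Proof. exact: ae_filter_ringOfSetsType. Qed.

(** * Translations, shears, rotations and sections for planar Lebesgue measure *)

Section Planar.
Variable R : realType.
Notation leb := (@lebesgue_measure R).
Notation leb2 := (leb \x leb)%E.

(** By uniqueness of Lebesgue measure it is enough to compare the pushforward with it on half-open
    intervals, where translation preserves length. *)
Lemma lebesgue_translation (a : R) : measure_preserving leb (fun s => s + a).
Proof.
have mg : measurable_fun [set: R] (fun s : R => s + a).
  by apply: measurable_funD => //; exact: measurable_cst.
split=> // A mA.
suff : pushforward leb ((fun s => s + a) : R -> measurableTypeR R) A = leb A by [].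
apply/esym/lebesgue_measure_unique => // _ [[b c] _ <-].
rewrite /pushforward /=.
rewrite [X in _ = leb X](_ : _ = `](b - a), (c - a)]%classic); last first.
  by apply/seteqP; split => s /=; rewrite !in_itv/= ltrBlDr lerBrDr.
rewrite !lebesgue_measure_itv/= !lte_fin ltrD2r; case: ifP => // _.
by rewrite -!EFinD; congr EFin; ring.
Qed.

(** The product measure integrates the measures of the sections at fixed first coordinate, and the
    shear merely translates each of these sections. *)
Lemma shear2 (u : R -> R) : measurable_fun [set: R] u ->
  measure_preserving leb2 (fun p : R * R => (p.1, p.2 + u p.1)).
Proof.
move=> mu; split.
  apply: measurable_fun_pair => //.
  by apply: measurable_funD => //; exact: measurableT_comp.
move=> A mA; apply: eq_integral => t _ /=.
have [_ tE] := lebesgue_translation (u t).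
rewrite -[RHS](tE (xsection A t)); last exact: measurable_xsection.
by congr (leb _); apply/seteqP; split => s; rewrite /xsection/= !inE.
Qed.

(** Tonelli for an indicator; it gives the sections at fixed second coordinate, which the other
    shear translates. *)
Lemma product_measure_swap (A : set (R * R)) : measurable A ->
  leb2 A = (\int[leb]_y leb (ysection A y))%E.
Proof.
move=> mA; have := indic_fubini_tonelli leb leb mA.
by rewrite indic_fubini_tonelli_FE// indic_fubini_tonelli_GE.
Qed.

Lemma shear1 (u : R -> R) : measurable_fun [set: R] u ->
  measure_preserving leb2 (fun p : R * R => (p.1 + u p.2, p.2)).
Proof.
move=> mu.
have mg : measurable_fun [set: R * R] (fun p : R * R => (p.1 + u p.2, p.2)).
  apply: measurable_fun_pair => //.
  by apply: measurable_funD => //; exact: measurableT_comp.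
split=> // A mA; rewrite /= !product_measure_swap//; last first.
  by rewrite -[X in measurable X]setTI; exact: mg.
apply: eq_integral => t _.
have [_ tE] := lebesgue_translation (u t).
rewrite -[RHS](tE (ysection A t)); last exact: measurable_ysection.
by congr (leb _); apply/seteqP; split => s; rewrite /ysection/= !inE.
Qed.

Lemma plane_translation (a b : R) :
  measure_preserving leb2 (fun p : R * R => (p.1 + a, p.2 + b)).
Proof.
exact: (measure_preserving_comp (shear1 (measurable_cst a))
  (shear2 (measurable_cst b))).
Qed.

Definition plane_rotation (c s : R) (p : R * R) :=
  (p.1 * c - p.2 * s, p.1 * s + p.2 * c).

(* With t = s / (1 + c), the tangent of the half angle, the rotation is the
   product of the shears of slopes -t, s and -t; this misses the half turn. *)
Let non_half_turn_measure_preserving c s : c ^+ 2 + s ^+ 2 = 1 -> 1 + c != 0 ->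
  measure_preserving leb2 (plane_rotation c s).
Proof.
move=> cs c1; pose u a (x : R) := a * x.
have mu a : measurable_fun [set: R] (u a) by exact: mulrl_measurable.
have := measure_preserving_comp (shear1 (mu (- (s / (1 + c)))))
  (measure_preserving_comp (shear2 (mu s)) (shear1 (mu (- (s / (1 + c)))))).
congr (measure_preserving _ _); apply/funext => -[x y] /=.
(* This is s^2 = (1 - c)(1 + c); both coordinates of the product of shears simplify through it. *)
have s2 : s * (s / (1 + c)) = 1 - c.
  by rewrite mulrA -expr2; apply: (canLR (mulfK c1)); lra.
rewrite /plane_rotation /u /=; congr (_, _); first last.
  have -> : y + s * (x + - (s / (1 + c)) * y) =
      y + s * x - (s * (s / (1 + c))) * y.
    by ring.
  by rewrite s2; ring.
have -> : x + - (s / (1 + c)) * y +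
    - (s / (1 + c)) * (y + s * (x + - (s / (1 + c)) * y)) =
  x - (s * (s / (1 + c))) * x - (2 - s * (s / (1 + c))) * (s / (1 + c)) * y.
  by ring.
rewrite s2; have -> : (2 - (1 - c)) * (s / (1 + c)) = s by field.
by ring.
Qed.

Lemma rotation_measure_preserving c s : c ^+ 2 + s ^+ 2 = 1 ->
  measure_preserving leb2 (plane_rotation c s).
Proof.
move=> cs; have [c1|c1] := eqVneq (1 + c) 0; last first.
  exact: non_half_turn_measure_preserving.
(* The remaining half turn is the square of the quarter turn, to which the factorization into shears
   applies. *)
have -> : plane_rotation c s = plane_rotation 0 1 \o plane_rotation 0 1.
  have -> : c = -1 by lra.
  have -> : s = 0 by apply/eqP; rewrite -sqrf_eq0; apply/eqP; nra.
  by apply/funext => -[x y]; rewrite /plane_rotation /=; congr (_, _); ring.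
by apply: measure_preserving_comp; apply: non_half_turn_measure_preserving;
  rewrite ?oner_neq0//; ring.
Qed.

(** The section measures of a planar null set are nonnegative with integral 0, hence vanish for
    almost every [t]. *)
Lemma ae_leb2_section (P : R * R -> Prop) : {ae leb2, forall p, P p} ->
  {ae leb, forall t, {ae leb, forall s, P (t, s)}}.
Proof.
move=> [N [mN N0 PN]].
have mX : measurable_fun [set: R] (fun t => leb (xsection N t)).
  exact: measurable_fun_xsection.
have : (\int[leb]_t `|leb (xsection N t)| = 0)%E.
  by rewrite -[RHS]N0; apply: eq_integral => t _; rewrite gee0_abs.
move/(ae_eq_integral_abs leb measurableT mX).
apply: filterS => t /(_ I) /= Nt0.
exists (xsection N t); split => //; first exact: measurable_xsection.
by move=> s /= nP; rewrite /xsection/= inE; exact: PN.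
Qed.

End Planar.

(** * Essential support, square integrability and integrability in the plane *)

Section SquareIntegrable.
Variable R : realType.
Notation leb := (@lebesgue_measure R).
Notation leb2 := (leb \x leb)%E.
Notation cfun := (R * R -> R[i]).

(* The boxes with rational corners form a countable base of the topology. *)
Lemma ae_zero_off_ess_supp (f : cfun) :
  {ae leb2, forall p, ~ ess_supp f p -> f p = 0}.
Proof.
pose box (q : rat * rat * (rat * rat)) : set (R * R) :=
  `]ratr q.1.1, ratr q.1.2[ `*` `]ratr q.2.1, ratr q.2.2[.
(* Rational boxes are indexed by their codes in the naturals, so that countably many null sets can
   be united. [P n] is vacuous when [n] codes no box or when [f] is not a.e. zero on the box. *)
pose P n (p : R * R) :=
  if @choice.unpickle (rat * rat * (rat * rat))%type n is Some q then
  {ae leb2, forall p, box q p -> f p = 0} -> box q p -> f p = 0 else True.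
have : {ae leb2, forall p, forall n, P n p}.
  apply: ae_foralln => n; rewrite /P.
  case: (choice.unpickle n) => [q|]; last exact: aeW.
  have [fq|nfq] := pselect {ae leb2, forall p, box q p -> f p = 0}.
    by move: fq; apply: filterS => p fp _.
  exact: aeW.
apply: filterS => -[x y] Pp /contrapT [U [oU fU] Up].
have [e /= e0 eU] : nbhs_ball (x, y) U.
  by apply/nbhs_ballP; exact: open_nbhs_nbhs.
(* Balls of the plane are products of intervals here, so the rational box can be chosen one
   coordinate at a time. *)
have rat_near (z : R) : exists2 q : rat * rat, ratr q.1 < z < ratr q.2 &
    `]ratr q.1, ratr q.2[ `<=` ball z e.
  have [a] : exists a, ratr a \in `]z - e, z[ by apply: rat_in_itvoo; lra.
  rewrite in_itv/= => /andP[az az'].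
  have [b] : exists b, ratr b \in `]z, z + e[ by apply: rat_in_itvoo; lra.
  rewrite in_itv/= => /andP[bz bz'].
  exists (a, b); rewrite /= ?az' ?bz//.
  rewrite ball_itv => w /=; rewrite !in_itv/= => /andP[? ?].
  by apply/andP; split; lra.
have [qx xq qxe] := rat_near x; have [qy yq qye] := rat_near y.
have := Pp (choice.pickle (qx, qy)); rewrite /P choice.pickleK; apply.
  move: fU; apply: filterS => -[u v] fuv [/= bu bv]; apply: fuv.
  by apply: eU; split; [exact: qxe|exact: qye].
by split; rewrite /= in_itv.
Qed.

Definition sqmod (z : R[i]) : R := complex.Re z ^+ 2 + complex.Im z ^+ 2.

Lemma sqmod_ge0 z : 0 <= sqmod z.
Proof. by rewrite addr_ge0// sqr_ge0. Qed.

(** The parallelogram identity with the term [sqmod (z - w)] dropped. *)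
Lemma sqmodD z w : sqmod (z + w) <= 2 * sqmod z + 2 * sqmod w.
Proof.
case: z => a b; case: w => c d; rewrite /sqmod /=.
have := sqr_ge0 (a - c); have := sqr_ge0 (b - d); nra.
Qed.

Lemma Re_mul (z w : R[i]) : complex.Re (z * w) =
  complex.Re z * complex.Re w - complex.Im z * complex.Im w.
Proof. by case: z w => a b []. Qed.

Lemma Im_mul (z w : R[i]) : complex.Im (z * w) =
  complex.Re z * complex.Im w + complex.Im z * complex.Re w.
Proof. by case: z w => a b []. Qed.

Lemma sqmodM z w : sqmod (z * w) = sqmod z * sqmod w.
Proof. by case: z => a b; case: w => c d; rewrite /sqmod /=; ring. Qed.

(** The integral is the square of the L^2 norm, so both are finite together; this removes the square
    roots from the later estimates. *)
Lemma L2P (f : cfun) : L2 f <->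
  [/\ measurable_fun [set: R * R] (fun x => complex.Re (f x)),
      measurable_fun [set: R * R] (fun x => complex.Im (f x)) &
      (\int[leb2]_x (sqmod (f x))%:E < +oo)%E].
Proof.
have normE : (\int[leb2]_x (`| (ComplexField.Normc.normc (f x))%:E | `^ 2) =
    \int[leb2]_x (sqmod (f x))%:E)%E.
  apply: eq_integral => x _; rewrite /sqmod; case: (f x) => a b /=.
  rewrite ger0_norm ?sqrtr_ge0// powR_mulrn ?sqrtr_ge0// sqr_sqrtr//.
  by rewrite addr_ge0// sqr_ge0.
split=> -[mRe mIm fin]; split=> //.
  have two0 : (2 : R) != 0 by rewrite pnatr_eq0.
  have := powR_Lnorm leb2
    (EFin \o (fun x => ComplexField.Normc.normc (f x))) two0.
  by rewrite /= normE => <-; exact: poweR_lty.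
by rewrite unlock; apply: poweR_lty; rewrite normE.
Qed.

Lemma measurable_sqmod (f : cfun) :
  measurable_fun [set: R * R] (fun x => complex.Re (f x)) ->
  measurable_fun [set: R * R] (fun x => complex.Im (f x)) ->
  measurable_fun [set: R * R] (fun x => (sqmod (f x))%:E).
Proof.
move=> mRe mIm; apply/measurable_EFinP.
by apply: measurable_funD; exact: measurable_funX.
Qed.

Lemma L2D (f g : cfun) : L2 f -> L2 g -> L2 (fun x => f x + g x).
Proof.
move=> /L2P[fRe fIm foo] /L2P[gRe gIm goo].
have mRe : measurable_fun [set: R * R] (fun x => complex.Re (f x + g x)).
  by under eq_fun do rewrite raddfD/=; exact: measurable_funD.
have mIm : measurable_fun [set: R * R] (fun x => complex.Im (f x + g x)).
  by under eq_fun do rewrite raddfD/=; exact: measurable_funD.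
apply/L2P; split => //.
have mf := measurable_sqmod fRe fIm; have mg := measurable_sqmod gRe gIm.
apply: (@le_lt_trans _ _
    (\int[leb2]_x (2%:E * (sqmod (f x))%:E + 2%:E * (sqmod (g x))%:E))%E).
  apply: ge0_le_integral => //.
  - by move=> x _; rewrite lee_fin sqmod_ge0.
  - exact: measurable_sqmod.
  - by apply: emeasurable_funD; exact: measurable_funeM.
  - by move=> x _; rewrite -!EFinM -EFinD lee_fin sqmodD.
rewrite ge0_integralD//; last 4 first.
- by move=> x _; rewrite mule_ge0// lee_fin sqmod_ge0.
- exact: measurable_funeM.
- by move=> x _; rewrite mule_ge0// lee_fin sqmod_ge0.
- exact: measurable_funeM.
rewrite !ge0_integralZl//; try by move=> x _; rewrite lee_fin sqmod_ge0.
by rewrite lte_add_pinfty// lte_mul_pinfty.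
Qed.

Lemma L2Z (d : R[i]) (f : cfun) : L2 f -> L2 (fun x => d * f x).
Proof.
move=> /L2P[fRe fIm foo]; apply/L2P; split.
- under eq_fun do rewrite Re_mul.
  by apply: measurable_funB; apply: measurable_funM => //; exact: measurable_cst.
- under eq_fun do rewrite Im_mul.
  by apply: measurable_funD; apply: measurable_funM => //; exact: measurable_cst.
- under eq_integral do rewrite sqmodM EFinM.
  rewrite ge0_integralZl// ?lte_mul_pinfty// ?lee_fin ?sqmod_ge0//.
    exact: measurable_sqmod.
  by move=> x _; rewrite lee_fin sqmod_ge0.
Qed.

Lemma L2_sum (I : finType) (F : I -> cfun) : (forall i, L2 (F i)) ->
  L2 (fun x => \sum_i F i x).
Proof.
move=> LF; elim: (index_enum I) => [|i s IH].
  under eq_fun do rewrite big_nil.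
  apply/L2P; split => //; try exact: measurable_cst.
  by under eq_integral do rewrite /sqmod/= expr0n/= addr0; rewrite integral0 ltry.
by under eq_fun do rewrite big_cons; exact: L2D.
Qed.

Lemma int_shift_translation (z : int * int) :
  measure_preserving leb2 (fun x : R * R => (x.1 - z.1%:~R, x.2 - z.2%:~R)).
Proof. exact: plane_translation. Qed.

Lemma L2_shift (f : cfun) z : L2 f -> L2 (int_shift f z).
Proof.
move=> /L2P[fRe fIm foo].
have mt : measurable_fun [set: R * R]
    (fun x : R * R => (x.1 - z.1%:~R, x.2 - z.2%:~R)).
  by case: (int_shift_translation z).
apply/L2P; split.
- exact: (measurableT_comp fRe mt).
- exact: (measurableT_comp fIm mt).
- rewrite (measure_preserving_ge0_integral (int_shift_translation z)
    (measurable_sqmod fRe fIm))//.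
  by move=> x; rewrite lee_fin sqmod_ge0.
Qed.

(* Off a null set, [|g (f x)| <= 1_B x + |f x|^2]. *)
Lemma L2_integrable (f : cfun) (B : set (R * R)) (g : R[i] -> R) :
  (forall z, g z ^+ 2 <= sqmod z) -> measurable_fun [set: R * R] (g \o f) ->
  L2 f -> measurable B -> (leb2 B < +oo)%E ->
  {ae leb2, forall x, ~ B x -> f x = 0} ->
  leb2.-integrable [set: R * R] (EFin \o g \o f).
Proof.
move=> gle mg /L2P[fRe fIm foo] mB Boo f0; apply/integrableP; split.
  exact/measurable_EFinP.
have mf := measurable_sqmod fRe fIm.
apply: (@le_lt_trans _ _ (\int[leb2]_x ((\1_B x)%:E + (sqmod (f x))%:E))%E).
  apply: ae_ge0_le_integral => //.
  - by apply: measurableT_comp => //; exact/measurable_EFinP.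
  - by move=> x _; rewrite adde_ge0 ?lee_fin ?sqmod_ge0.
  - by apply: emeasurable_funD => //; exact/measurable_EFinP/measurable_indic.
  - move: f0; apply: filterS => x fx _; rewrite /= -EFinD lee_fin indicE.
    (* On [B], expanding (|g| - 1)^2 >= 0 bounds |g| by 1 + |g|^2. Off [B], [f x] is 0, and the
       bound on [g] forces [g 0 = 0]. *)
    have [xB|xB] := boolP (x \in B).
      have := gle (f x); rewrite -real_normK ?num_real//= => gx.
      have := sqr_ge0 (`|g (f x)| - 1); have := normr_ge0 (g (f x)); nra.
    have fx0 : f x = 0 by apply: fx => Bx; move: xB; rewrite mem_set.
    have := gle (f x); rewrite fx0 /sqmod/= expr0n/= !addr0 => g0.
    have -> : g 0 = 0 by apply/eqP; rewrite -sqrf_eq0 eq_le g0 sqr_ge0.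
    by rewrite normr0.
rewrite ge0_integralD//; last 2 first.
- exact/measurable_EFinP/measurable_indic.
- by move=> x _; rewrite lee_fin sqmod_ge0.
by rewrite integral_indic// setIT lte_add_pinfty.
Qed.

End SquareIntegrable.

(** * Integration of complex functions on the line *)

Section ComplexIntegral.
Variable R : realType.
Notation leb := (@lebesgue_measure R).
Implicit Types F G : R -> R[i].

Definition cmeasurable F :=
  measurable_fun [set: R] (fun s => complex.Re (F s)) /\
  measurable_fun [set: R] (fun s => complex.Im (F s)).

Definition cintegrable F :=
  leb.-integrable [set: R] (fun s => (complex.Re (F s))%:E) /\
  leb.-integrable [set: R] (fun s => (complex.Im (F s))%:E).

(** Taken componentwise as in [radon], so that [radonE] holds by conversion. *)
Definition cintegral F : R[i] :=
  Complex (\int[leb]_s complex.Re (F s)) (\int[leb]_s complex.Im (F s)).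

Lemma cintegrable0 : cintegrable (fun=> 0).
Proof. by split; exact: integrable0. Qed.

Lemma cintegral0 : cintegral (fun=> 0) = 0.
Proof. by rewrite /cintegral /Rintegral integral0. Qed.

Lemma cintegrableD F G : cintegrable F -> cintegrable G ->
  cintegrable (fun s => F s + G s).
Proof.
move=> [FR FI] [GR GI]; split.
  under eq_fun do rewrite raddfD/= EFinD; exact: integrableD.
under eq_fun do rewrite raddfD/= EFinD; exact: integrableD.
Qed.

Lemma cintegralD F G : cintegrable F -> cintegrable G ->
  cintegral (fun s => F s + G s) = cintegral F + cintegral G.
Proof.
move=> [FR FI] [GR GI]; rewrite /cintegral.
under eq_Rintegral do rewrite raddfD/=.
rewrite RintegralD//.
under [X in Complex _ X]eq_Rintegral do rewrite raddfD/=.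
by rewrite RintegralD.
Qed.

Lemma cintegrableZ d F : cintegrable F -> cintegrable (fun s => d * F s).
Proof.
move=> [FR FI]; split.
  under eq_fun do rewrite Re_mul EFinB !EFinM.
  by apply: integrableB => //; exact: integrableZl.
under eq_fun do rewrite Im_mul EFinD !EFinM.
by apply: integrableD => //; exact: integrableZl.
Qed.

Lemma cintegralZ d F : cintegrable F ->
  cintegral (fun s => d * F s) = d * cintegral F.
Proof.
move=> [FR FI].
have iZ (r : R) (f : R -> R) : leb.-integrable [set: R] (EFin \o f) ->
    leb.-integrable [set: R] (fun s => (r * f s)%:E).
  by move=> fi; under eq_fun do rewrite EFinM; exact: integrableZl.
rewrite /cintegral.
under eq_Rintegral do rewrite Re_mul.
rewrite RintegralB ?RintegralZl//; try exact: iZ.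
under [X in Complex _ X]eq_Rintegral do rewrite Im_mul.
rewrite RintegralD ?RintegralZl//; try exact: iZ.
by case: d => a b.
Qed.

Lemma cintegral_lincomb (I : finType) (d : I -> R[i]) (F : I -> R -> R[i]) :
  (forall i, cintegrable (F i)) ->
  cintegral (fun s => \sum_i d i * F i s) = \sum_i d i * cintegral (F i).
Proof.
move=> iF.
(* Integrability of the partial sum is carried through the induction because additivity of the
   integral asks for it. *)
suff [] : cintegrable (fun s => \sum_i d i * F i s) /\
  cintegral (fun s => \sum_i d i * F i s) = \sum_i d i * cintegral (F i) by [].
elim: (index_enum I) => [|i r [IH1 IH2]].
  under eq_fun do rewrite big_nil.
  rewrite big_nil; split; first exact: cintegrable0.
  exact: cintegral0.
under eq_fun do rewrite big_cons.
have iZ := cintegrableZ (d i) (iF i).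
rewrite big_cons -IH2 -cintegralZ//; split; first exact: cintegrableD.
by rewrite -cintegralD.
Qed.

Lemma cintegral_ae_eq F G : cmeasurable F -> cmeasurable G ->
  {ae leb, forall s, F s = G s} -> cintegral F = cintegral G.
Proof.
move=> [FR FI] [GR GI] FG; rewrite /cintegral /Rintegral; congr Complex; congr fine.
  apply: ae_eq_integral => //; try exact/measurable_EFinP.
  by apply: filterS FG => s -> _.
apply: ae_eq_integral => //; try exact/measurable_EFinP.
by apply: filterS FG => s -> _.
Qed.

Lemma cintegrable_translation F a : cintegrable F ->
  cintegrable (fun s => F (s + a)).
Proof.
move=> [FR FI]; split.
  exact: (measure_preserving_integrable (lebesgue_translation a) FR).
exact: (measure_preserving_integrable (lebesgue_translation a) FI).
Qed.

Lemma cintegral_translation F a : cmeasurable F ->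
  cintegral (fun s => F (s + a)) = cintegral F.
Proof.
move=> [/measurable_EFinP FR /measurable_EFinP FI].
rewrite /cintegral /Rintegral; congr Complex; congr fine.
  exact: (measure_preserving_integral (lebesgue_translation a) FR).
exact: (measure_preserving_integral (lebesgue_translation a) FI).
Qed.

End ComplexIntegral.

(** * The Radon transform at a fixed angle and its continuous representative *)

Section Radon.
Variables (R : realType) (theta : R).
Notation leb := (@lebesgue_measure R).
Notation leb2 := (leb \x leb)%E.

Let rotate := plane_rotation (cos theta) (sin theta).

Definition on_line (f : R * R -> R[i]) (t s : R) : R[i] := f (rotate (t, s)).

Lemma radonE f t : radon theta f t = cintegral (on_line f t).
Proof. by []. Qed.

Let rotate_mp : measure_preserving leb2 rotate.
Proof. by apply: rotation_measure_preserving; exact: cos2Dsin2. Qed.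

Lemma cmeasurable_on_line f t : L2 f -> cmeasurable (on_line f t).
Proof.
move=> [fR fI _].
have mr : measurable_fun [set: R] (fun s => rotate (t, s)).
  have mr : measurable_fun [set: R * R] rotate by case: rotate_mp.
  by apply: (measurableT_comp mr).
by split; [exact: (measurableT_comp fR mr)|exact: (measurableT_comp fI mr)].
Qed.

(** In the rotated frame [z] has coordinates [pdot theta z] and z_2 cos - z_1 sin: the first moves
    the line, the second slides along it. *)
Lemma on_line_int_shift f z t : on_line (int_shift f z) t =
  (fun s => on_line f (t - pdot theta z)
     (s + (z.1%:~R * sin theta - z.2%:~R * cos theta))).
Proof.
apply/funext => s; rewrite /on_line /int_shift /rotate /plane_rotation /pdot/=.
have cs := cos2Dsin2 theta; congr (f (_, _)).
  by rewrite -[in LHS](mulr1 z.1%:~R) -cs; ring.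
by rewrite -[in LHS](mulr1 z.2%:~R) -cs; ring.
Qed.

(** Valid at every [t], even on lines where the integral diverges, because translation invariance
    equates the extended real integrals before [fine] is applied. *)
Lemma radon_int_shift f z t : L2 f ->
  radon theta (int_shift f z) t = radon theta f (t - pdot theta z).
Proof.
move=> fL2; rewrite !radonE on_line_int_shift cintegral_translation//.
exact: cmeasurable_on_line.
Qed.

Lemma ae_cintegrable_on_line f (B : set (R * R)) : L2 f -> measurable B ->
  (leb2 B < +oo)%E -> {ae leb2, forall x, ~ B x -> f x = 0} ->
  {ae leb, forall t, cintegrable (on_line f t)}.
Proof.
move=> fL2 mB Boo f0; have [fR fI _] := fL2.
have Rle (z : R[i]) : complex.Re z ^+ 2 <= sqmod z by rewrite lerDl sqr_ge0.
have Ile (z : R[i]) : complex.Im z ^+ 2 <= sqmod z by rewrite lerDr sqr_ge0.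
have iR := L2_integrable Rle fR fL2 mB Boo f0.
have iI := L2_integrable Ile fI fL2 mB Boo f0.
have aR := ae_integrable1 (measure_preserving_integrable rotate_mp iR).
have aI := ae_integrable1 (measure_preserving_integrable rotate_mp iI).
by apply: filterS2 aR aI => t; split.
Qed.

(** Two null sets of [t] are discarded: the finitely many translates of the set of lines on which
    [f] is not integrable, and the lines that meet the exceptional planar set of [hE] in a non-null
    set. *)
Lemma radon_lincomb f (m : nat) (k : 'I_m -> int * int) (d : 'I_m -> R[i]) h :
  L2 f -> L2 h -> {ae leb, forall t, cintegrable (on_line f t)} ->
  {ae leb2, forall x, h x = \sum_(l < m) d l * int_shift f (k l) x} ->
  {ae leb, forall t, radon theta h t =
    \sum_(l < m) d l * radon theta f (t - pdot theta (k l))}.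
Proof.
move=> fL2 hL2 fi hE.
have {}fi : {ae leb, forall t, forall l,
    cintegrable (on_line f (t - pdot theta (k l)))}.
  apply: filter_forall => l.
  exact: (measure_preserving_ae (lebesgue_translation _) fi).
have := ae_leb2_section (measure_preserving_ae rotate_mp hE).
apply: filterS2 fi => t fi {}hE.
rewrite radonE (@cintegral_ae_eq _ _
  (fun s => \sum_l d l * on_line (int_shift f (k l)) t s))//.
- rewrite cintegral_lincomb.
    by apply: eq_bigr => l _; rewrite -radonE radon_int_shift.
  by move=> l; rewrite on_line_int_shift; exact: cintegrable_translation.
- exact: cmeasurable_on_line.
- have L2sum : L2 (fun x => \sum_l d l * int_shift f (k l) x).
    by apply: L2_sum => l; exact/L2Z/L2_shift.
  exact: (cmeasurable_on_line t L2sum).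
Qed.

(** If the functions differ at [t], they differ on a whole ball around it, which has positive
    measure. *)
Lemma continuous_ae_eq (g1 g2 : R -> R[i]^o) : continuous g1 -> continuous g2 ->
  {ae leb, forall t, g1 t = g2 t} -> g1 = g2.
Proof.
move=> c1 c2 g12; apply/funext => t; apply: contrapT => /eqP.
rewrite -subr_eq0 => gt.
have cg : {for t, continuous (fun t => g1 t - g2 t)}.
  by apply: continuousB; [exact: c1|exact: c2].
have : \forall s \near t, g1 s - g2 s != 0.
  by apply: (cvgr_neq0 _ cg).
move=> /nbhs_ballP[e /= e0 ge].
case: g12 => N [mN N0 gN].
have : (leb (ball t e) <= leb N)%E.
  apply: le_measure; rewrite ?inE//; first exact: measurable_ball.
  by move=> s /ge gs; apply: gN => /= /eqP; rewrite -subr_eq0; apply/negP.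
by rewrite N0 (lebesgue_measure_ball t (ltW e0)) leNgt lte_fin mulrn_wgt0.
Qed.

(** The arbitrary choice made by [xget] is harmless: any two continuous representatives agree a.e.,
    hence everywhere. *)
Lemma radon_contP f g :
  continuous_radon_rep theta f g -> radon_cont theta f = g.
Proof.
move=> fg; have := xgetPex (radon theta f) (ex_intro _ g fg).
rewrite -/(radon_cont theta f) => -[c1 e1]; case: fg => c2 e2.
apply: continuous_ae_eq => //.
by apply: filterS2 e1 e2 => t -> ->.
Qed.

Lemma radon_cont_lincomb f (m : nat) (k : 'I_m -> int * int)
    (d : 'I_m -> R[i]) h t :
  L2 f -> L2 h -> has_continuous_radon theta f ->
  {ae leb, forall t, cintegrable (on_line f t)} ->
  {ae leb2, forall x, h x = \sum_(l < m) d l * int_shift f (k l) x} ->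
  radon_cont theta h t =
    \sum_(l < m) d l * radon_cont theta f (t - pdot theta (k l)).
Proof.
move=> fL2 hL2 [g fg] fi hE; rewrite (radon_contP fg); case: fg => cg gE.
(* [G] is continuous and agrees a.e. with the transform of [h], so it is the representative of [h].
   This upgrades the a.e. identity to one at every sampling point. *)
pose G t := \sum_(l < m) d l * g (t - pdot theta (k l)).
suff -> : radon_cont theta h = G by [].
apply: radon_contP; split.
  move=> u; apply: (@cvg_big (R[i]^o) _ +%R 0 xpredT) => [|l _].
    exact: add_continuous.
  apply: (@cvgZl_tmp _ R[i]^o).
  apply: (@continuous_comp _ _ _ (fun t => t - pdot theta (k l))
    (g : R -> R[i]^o)); last exact: cg.
  by apply: continuousB => //; exact: cst_continuous.
have {}gE : {ae leb, forall t, forall l,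
    g (t - pdot theta (k l)) = radon theta f (t - pdot theta (k l))}.
  apply: filter_forall => l.
  exact: (measure_preserving_ae (lebesgue_translation _) gE).
apply: filterS2 gE (radon_lincomb fL2 hL2 fi hE) => u gu ->.
by apply: eq_bigr => l _; rewrite gu.
Qed.

End Radon.

Lemma shifts_independent_enum (R : realType) (phi : R * R -> R[i]) (m : nat)
    (k : 'I_m -> int * int) (v : 'I_m -> R[i]) :
  shifts_independent phi -> injective k ->
  {ae (@lebesgue_measure R \x @lebesgue_measure R)%E, forall x,
    \sum_(l < m) v l * int_shift phi (k l) x = 0} ->
  forall l, v l = 0.
Proof.
move=> ind kinj sum0 l.
(* Coefficients on the integer lattice are obtained by summing [v] over the fibres of [k]; by
   injectivity each fibre has at most one element. *)
pose c z := \sum_(i | k i == z) v i.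
have cE i : c (k i) = v i.
  by rewrite /c (big_pred1 i)// => j; rewrite (inj_eq kinj).
rewrite -cE; apply: (ind [fset k i | i in 'I_m]%fset c); last exact: in_imfset.
move: sum0; apply: filterS => x x0; rewrite -[RHS]x0.
rewrite big_imfset/=; last by move=> i j _ _; exact: kinj.
by rewrite big_enum; apply: eq_bigr => i _; rewrite cE.
Qed.

(** * Unique determination and invertibility of the sampling matrix *)

Unset Implicit Arguments.

Theorem theorem4p1 (R : realType) (phi : R * R -> R[i])
    (N1 M1 N2 M2 theta a1 b1 a2 b2 : R)
    (phi_L2 : L2 phi)
    (phi_supp : ess_supp phi `<=` `[N1, M1] `*` `[N2, M2])
    (phi_indep : shifts_independent phi)
    (phi_radon : has_continuous_radon theta phi)
    (m : nat) (k : 'I_m -> int * int)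
    (k_enum : set_bij [set: 'I_m] (index_set N1 M1 N2 M2 a1 b1 a2 b2) k)
    (f : R * R -> R[i])
    (f_target : target_function phi a1 b1 a2 b2 k f)
    (x : 'I_m -> R) :
  determined_by_radon_samples phi theta k (range x) f <->
  sampling_matrix phi theta k x \in unitmx.
Proof.
have k_inj : injective k.
  by move=> i j kij; have [_ kI _] := k_enum; apply: kI; rewrite ?inE.
have phi_line :
    {ae @lebesgue_measure R, forall t, cintegrable (on_line theta phi t)}.
  apply: (@ae_cintegrable_on_line _ _ _ (`[N1, M1] `*` `[N2, M2])) => //.
  - exact: measurableX.
  (* The intervals may be empty, hence the case distinctions on their measures. *)
  - rewrite /= product_measure1E//= lte_mul_pinfty//= !lebesgue_measure_itv/=.
      by case: ifP => //; rewrite -EFinD.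
    by case: ifP => // _; rewrite -EFinD ltry.
  - have := ae_zero_off_ess_supp phi; apply: filterS => p p0 nBp.
    by apply: p0 => /phi_supp.
set A := sampling_matrix _ _ _ _.
have samplesE h (d : 'I_m -> R[i]) : L2 h ->
    {ae (@lebesgue_measure R \x @lebesgue_measure R)%E, forall y,
      h y = \sum_(l < m) d l * int_shift phi (k l) y} ->
    forall j, radon_cont theta h (x j) = (A *m \col_l d l) j 0.
  move=> hL2 hE j.
  rewrite (radon_cont_lincomb _ phi_L2 hL2 phi_radon phi_line hE).
  by rewrite mxE; apply: eq_bigr => l _; rewrite !mxE mulrC.
have [_ _ [fL2 [e fE]]] := f_target; split.
- move=> det_f; apply: contrapT => /negP.
  (* [det0P] yields a row vector killed on the left; applying it to the transpose of [A] gives a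
     nonzero kernel column [v^T]. *)
  rewrite unitmxE unitfE negbK -det_tr => /det0P[v v0 vA].
  have {}vA : A *m v^T = 0 by rewrite -[A]trmxK -trmx_mul vA trmx0.
  pose g y := \sum_(l < m) v 0 l * int_shift phi (k l) y.
  have gL2 : L2 g by apply: L2_sum => l; exact/L2Z/L2_shift.
  (* The competitor [f + g] has the same samples as [f] since [A] kills [v^T]. Uniqueness then makes
     [g] vanish a.e., and independence of the shifts contradicts [v0]. *)
  have hL2 : L2 (fun y => f y + g y) by exact: L2D.
  have hE : {ae (@lebesgue_measure R \x @lebesgue_measure R)%E, forall y,
      f y + g y = \sum_(l < m) (e l + v 0 l) * int_shift phi (k l) y}.
    move: fE; apply: filterS => y ->; rewrite /g -big_split/=.
    by apply: eq_bigr => l _; rewrite mulrDl.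
  have hf : {ae (@lebesgue_measure R \x @lebesgue_measure R)%E, forall y,
      f y + g y = f y}.
    apply: det_f; first by split => //; exists (fun l => e l + v 0 l).
    move=> _ [j _ <-]; rewrite (samplesE _ _ hL2 hE) (samplesE _ _ fL2 fE).
    rewrite (_ : \col_l _ = \col_l e l + v^T); last first.
      by apply/colP => l; rewrite !mxE.
    by rewrite mulmxDr vA addr0.
  have v_eq0 : forall l, v 0 l = 0.
    apply: (shifts_independent_enum (v := fun l => v 0 l) phi_indep k_inj).
    move: hf; apply: filterS => y /eqP.
    by rewrite -subr_eq0 addrAC subrr add0r => /eqP.
  by move/eqP: v0; apply; apply/rowP => l; rewrite mxE.
- move=> A_unit h [hL2 [d hE]] hf.
  (* Equality of samples is equality of these products, and cancelling [A] identifies the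
     coefficients. *)
  have Ade : A *m \col_l d l = A *m \col_l e l.
    apply/colP => j; rewrite -(samplesE _ _ hL2 hE) -(samplesE _ _ fL2 fE).
    by apply: hf; exists j.
  have /colP de : \col_l d l = \col_l e l.
    by rewrite -[LHS](mulKmx A_unit) Ade mulKmx.
  apply: filterS2 hE fE => y -> ->.
  by apply: eq_bigr => l _; have := de l; rewrite !mxE => ->.
Qed.
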